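(* Let $t_n$ be the total number of grand knight's paths of size $n$ ending at a non-negative altitude. Then $$\sum_{n\ge 0}t_nz^n=\frac{h_0u_1u_2-h_1}{(1-u_1)(1-u_2)},$$ where $$u_1=\frac{-z^2+\sqrt{z^4+8z^2+4z}}{4z}+\frac{1}{2\sqrt2}\sqrt{\frac{z^3-z\sqrt{z^4+8z^2+4z}-4z+2}{z}},$$ $$u_2=\frac{-z^2-\sqrt{z^4+8z^2+4z}}{4z}-\frac{1}{2\sqrt2}\sqrt{\frac{z^3+z\sqrt{z^4+8z^2+4z}-4z+2}{z}},$$ $$h_0=\frac{1+u_1u_2}{1+u_1u_2-2z^2(u_1+u_2)-2z+2z(1-u_1^2-u_2^2)u_1^{-1}u_2^{-1}},\qquad h_1=\frac{u_1+u_2}{1+u_1u_2}\,h_0 .$$ Moreover, as $n\to\infty$, $$t_n\sim\frac{\sqrt3}{12}\left(1+\sqrt3\right)^{n+1}.$$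
   Context: A grand knight's path is a lattice path in $\mathbb{Z}^2$ that starts at the origin and consists of steps $N=(1,2)$, $\bar N=(1,-2)$, $E=(2,1)$, $\bar E=(2,-1)$ (the empty path is allowed). Its size is the $x$-coordinate of its last point and its altitude is the $y$-coordinate of its last point. The functions $u_1,u_2$ are understood as (Laurent) series in $z^{1/2}$ near $z=0$, with the branches of the square roots given by principal values for small $z>0$ (so $u_1\sim z^{-1/2}$, $u_2\sim -z^{-1/2}$). The notation $a_n\sim b_n$ means $a_n/b_n\to1$. *)

(* Defs.v *)
From HB Require Import structures.
From mathcomp Require Import all_boot all_order all_algebra.
From mathcomp Require Import finmap.
From mathcomp Require Import all_classical all_reals all_analysis.

Set Implicit Arguments.
Unset Strict Implicit.
Unset Printing Implicit Defensive.

Import Order.TTheory GRing.Theory Num.Theory.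
Import numFieldNormedType.Exports.

Local Open Scope classical_set_scope.
Local Open Scope ring_scope.

Definition knight_steps : seq (int * int) :=
  [:: (1, 2); (1, -2); (2, 1); (2, -1)].

(* A path starting at the origin is encoded by its sequence of steps. *)
Definition grand_knight_path (p : seq (int * int)) : bool :=
  all [in knight_steps] p.

Definition endpoint (p : seq (int * int)) : int * int := \sum_(s <- p) s.

Definition path_size (p : seq (int * int)) : int := (endpoint p).1.

Definition altitude (p : seq (int * int)) : int := (endpoint p).2.

Definition nonneg_paths (n : nat) : set (seq (int * int)) :=
  [set p | [/\ grand_knight_path p, path_size p = n%:Z & 0 <= altitude p]].

Lemma path_size_ge (p : seq (int * int)) :
  grand_knight_path p -> (size p)%:Z <= path_size p.
Proof.
rewrite /path_size /endpoint; elim: p => [|s p IHp] /=; first by rewrite big_nil.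
move=> /andP[Hs Hp]; rewrite big_cons -add1n PoszD /= lerD ?IHp //.
by move: Hs; rewrite !inE => /or4P[] /eqP ->.
Qed.

(* [fset_set] sends infinite sets to the empty one: this makes [t] below a
   genuine cardinality. *)
Lemma finite_nonneg_paths (n : nat) : finite_set (nonneg_paths n).
Proof.
pose f (b : n.-bseq 'I_4) := [seq nth 0 knight_steps i | i : 'I_4 <- b].
apply: (@sub_finite_set _ _ (f @` setT)); last exact: finite_image.
move=> p [pP pn _].
have szp : (size [seq inord (index s knight_steps) : 'I_4 | s <- p] <= n)%N.
  by rewrite size_map -lez_nat -pn path_size_ge.
exists (Bseq szp) => //; rewrite /f /= -map_comp -[RHS]map_id.
apply/eq_in_map => s /(allP pP) sP /=.
by rewrite inordK ?nth_index //; move: sP; rewrite -index_mem.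
Qed.

Definition t (n : nat) : nat := #|` fset_set (nonneg_paths n)|.

Section KernelRoots.
Context {R : realType}.
Implicit Type z : R.

Definition rad0 z : R := z ^+ 4 + 8 * z ^+ 2 + 4 * z.

Definition rad1 z : R :=
  (z ^+ 3 - z * Num.sqrt (rad0 z) - 4 * z + 2) / z.

Definition rad2 z : R :=
  (z ^+ 3 + z * Num.sqrt (rad0 z) - 4 * z + 2) / z.

Definition u1 z : R :=
  (- z ^+ 2 + Num.sqrt (rad0 z)) / (4 * z)
  + 1 / (2 * Num.sqrt 2) * Num.sqrt (rad1 z).

Definition u2 z : R :=
  (- z ^+ 2 - Num.sqrt (rad0 z)) / (4 * z)
  - 1 / (2 * Num.sqrt 2) * Num.sqrt (rad2 z).

Definition h0_den z : R :=
  1 + u1 z * u2 z - 2 * z ^+ 2 * (u1 z + u2 z) - 2 * z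
  + 2 * z * (1 - u1 z ^+ 2 - u2 z ^+ 2) * (u1 z)^-1 * (u2 z)^-1.

Definition h0 z : R := (1 + u1 z * u2 z) / h0_den z.

Definition h1 z : R := (u1 z + u2 z) / (1 + u1 z * u2 z) * h0 z.

(* [Num.sqrt] is 0 on negative numbers and [0^-1 = 0]: this predicate says that
   no such default value is used in the formulas above (for [z != 0]). *)
Definition well_defined z : Prop :=
  [/\ [/\ 0 <= rad0 z, 0 <= rad1 z & 0 <= rad2 z],
      [/\ u1 z != 0, u2 z != 0, 1 + u1 z * u2 z != 0 & h0_den z != 0]
    & (1 - u1 z) * (1 - u2 z) != 0].

End KernelRoots.

(* Main.v *)
Require Import Defs.
From mathcomp Require Import all_boot all_order all_algebra.
From mathcomp Require Import finmap.
From mathcomp Require Import all_classical all_reals all_analysis.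
From mathcomp Require Import ring lra zify.

Set Implicit Arguments.
Unset Strict Implicit.
Unset Printing Implicit Defensive.

Import Order.TTheory GRing.Theory Num.Theory.
Import numFieldNormedType.Exports.

Local Open Scope classical_set_scope.
Local Open Scope ring_scope.

(* By the symmetry of the steps, twice the number of paths of size n ending at a
   non-negative altitude is a_n + e_n, with a_n the number of all paths of size
   n and e_n the number of those that end at altitude 0.

   For small z > 0 the generating functions c_j of the paths ending at altitude
   j form the unique bounded solution of a linear recurrence in j.  This is
   the combination of u1^-|j| and u2^-|j| given by the partial fraction
   expansion of 1/K, K = 1 - z (u^2 + u^-2) - z^2 (u + 1/u), in w = u + 1/u:
   K is quadratic in w with the roots u1 + 1/u1 and u2 + 1/u2.  The rest is
   algebra, with 1/K(1) the generating function of all paths.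

   For the asymptotics, a_n is explicit and it remains to see that the
   proportion e_n / (1 + sqrt 3)^n tends to 0.  Let beta be the limsup over n of
   the largest proportion of paths of size n at a single altitude.  A near-
   maximal proportion at (n, j) forces near-maximal ones at (n - 1, j - 2) and
   (n - 1, j + 2), hence, after k steps, at k + 1 altitudes at once.  These
   proportions add up to at most 1, so (k + 1) beta / 2 <= 1 for all k. *)

(** * Enumeration of the paths and counts by altitude *)

Fixpoint knight_paths (n : nat) : seq (seq (int * int)) :=
  if n is m.+1 then
    [seq (1, 2) :: p | p <- knight_paths m] ++
    [seq (1, -2) :: p | p <- knight_paths m] ++
    if m is k.+1 then
      [seq (2, 1) :: p | p <- knight_paths k] ++
      [seq (2, -1) :: p | p <- knight_paths k]
    else [::]
  else [:: [::]].

Lemma knight_pathsSS n :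
  knight_paths n.+2 =
    [seq (1, 2) :: p | p <- knight_paths n.+1] ++
    [seq (1, -2) :: p | p <- knight_paths n.+1] ++
    [seq (2, 1) :: p | p <- knight_paths n] ++
    [seq (2, -1) :: p | p <- knight_paths n].
Proof. by []. Qed.

(** A predicate instead of one altitude, so that a single recurrence on the first step serves all
    paths, those at a fixed altitude and those at non-negative altitude. *)
Definition altitude_count (P : int -> bool) (n : nat) : nat :=
  count (fun p => P (altitude p)) (knight_paths n).

Lemma altitude_count0 (P : int -> bool) : altitude_count P 0 = P 0.
Proof. by rewrite /altitude_count /= /altitude /endpoint big_nil addn0. Qed.

Lemma altitude_cons (s : int * int) p : altitude (s :: p) = s.2 + altitude p.
Proof. by rewrite /altitude /endpoint big_cons. Qed.

Lemma path_size_cons (s : int * int) p : path_size (s :: p) = s.1 + path_size p.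
Proof. by rewrite /path_size /endpoint big_cons. Qed.

Lemma altitude_count1 (P : int -> bool) :
  altitude_count P 1 = (altitude_count (fun y => P (2 + y)%R) 0 +
    altitude_count (fun y => P (-2 + y)%R) 0)%N.
Proof.
by rewrite !altitude_count0 /altitude_count /= !altitude_cons
  /altitude /endpoint big_nil /= addn0.
Qed.

Lemma altitude_countSS (P : int -> bool) n :
  altitude_count P n.+2 = (altitude_count (fun y => P (2 + y)%R) n.+1 +
    altitude_count (fun y => P (-2 + y)%R) n.+1 +
    altitude_count (fun y => P (1 + y)%R) n +
    altitude_count (fun y => P (-1 + y)%R) n)%N.
Proof.
rewrite /altitude_count knight_pathsSS 3!count_cat 4!count_map -!addnA.
by do ![congr addn]; apply: eq_count => p; rewrite /= altitude_cons.
Qed.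

Lemma nat_ind2 (P : nat -> Prop) :
  P 0 -> P 1 -> (forall n, P n -> P n.+1 -> P n.+2) -> forall n, P n.
Proof.
move=> P0 P1 PSS n; suff: P n /\ P n.+1 by case.
by elim: n => // n [Pn PSn]; split => //; exact: PSS.
Qed.

(** Reflection in the x-axis swaps the two steps of each length, so the recurrence is invariant
    under it. *)
Lemma altitude_count_opp (P : int -> bool) n :
  altitude_count (fun y => P (- y)) n = altitude_count P n.
Proof.
elim/nat_ind2: n P => [||n IHn IHSn] P.
- by rewrite !altitude_count0 oppr0.
- by rewrite !altitude_count1 !altitude_count0 !addr0 opprK addnC.
- rewrite !altitude_countSS.
  rewrite -(IHSn (fun y => P (2 + y))) -(IHSn (fun y => P (-2 + y))).
  rewrite -(IHn (fun y => P (1 + y))) -(IHn (fun y => P (-1 + y))).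
  rewrite [in RHS](addnC (altitude_count (fun y => P (2 - y)) n.+1)).
  rewrite -!addnA [in RHS](addnC (altitude_count (fun y => P (1 - y)) n)).
  by do ![congr addn]; rewrite /altitude_count; apply: eq_count => p;
    rewrite opprD ?opprK.
Qed.

Lemma mem_map_cons (T : eqType) (s x : T) (q : seq T) (r : seq (seq T)) :
  (x :: q \in [seq s :: p | p <- r]) = (x == s) && (q \in r).
Proof.
apply/mapP/andP => [[p pr [-> ->]]|[/eqP -> qr]]; last by exists q.
by rewrite eqxx.
Qed.

Lemma mem_knight_paths n p :
  (p \in knight_paths n) = grand_knight_path p && (path_size p == n%:Z).
Proof.
elim/nat_ind2: n p => [||n IHn IHSn] p.
- rewrite inE; case: p => [|s p]; first by rewrite /path_size /endpoint big_nil.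
  apply/esym/negbTE/negP => /andP[/path_size_ge /[swap] /eqP ->] /=.
  by rewrite lez_nat.
- case: p => [|s p]; first by rewrite /path_size /endpoint big_nil.
  rewrite /= !inE !eqseq_cons path_size_cons.
  have szp : (p == [::]) = grand_knight_path p && (path_size p == 0).
    case: p => [|s' p]; first by rewrite /path_size /endpoint big_nil.
    apply/esym/negbTE/negP => /andP[/path_size_ge /[swap] /eqP ->].
    by rewrite lez_nat.
  (* Rules out a step of length 2 followed by a path of size -1. *)
  have szp' : grand_knight_path p -> 0 <= path_size p.
    by move=> /path_size_ge; apply: le_trans.
  rewrite -/(grand_knight_path p) szp.
  case: (s =P (1, 2)) => [->|_] /=; first lia.
  case: (s =P (1, -2)) => [->|_] /=; first lia.
  case: (s =P (2, 1)) => [->|_] /=; first lia.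
  case: (s =P (2, -1)) => [->|_] //=; lia.
- case: p => [|s p].
    rewrite knight_pathsSS !mem_cat /path_size /endpoint big_nil.
    do ![rewrite (negbTE (_ : _ \notin map _ _)) //;
      last by apply/mapP => -[]].
  rewrite knight_pathsSS !mem_cat !mem_map_cons IHn IHSn.
  rewrite path_size_cons /= !inE -/(grand_knight_path p).
  case: (s =P (1, 2)) => [->|_] /=; first lia.
  case: (s =P (1, -2)) => [->|_] /=; first lia.
  case: (s =P (2, 1)) => [->|_] /=; first lia.
  case: (s =P (2, -1)) => [->|_] //=; lia.
Qed.

Lemma uniq_knight_paths n : uniq (knight_paths n).
Proof.
have disj (s s' : int * int) (r r' : seq (seq (int * int))) : s != s' ->
    ~~ has [in [seq s :: p | p <- r]] [seq s' :: p | p <- r'].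
  move=> ss'; apply/hasPn => _ /mapP[p _ ->] /=.
  by rewrite mem_map_cons eq_sym (negbTE ss').
have inj (s : int * int) : injective (cons s) by move=> p q [].
elim/nat_ind2: n => [//|//|n IHn IHSn].
rewrite knight_pathsSS !cat_uniq !map_inj_uniq//.
by rewrite IHn IHSn !has_cat !negb_or !disj.
Qed.

Lemma t_altitude_count n : t n = altitude_count (fun y => 0 <= y) n.
Proof.
rewrite /t /altitude_count -size_filter.
have -> : fset_set (nonneg_paths n) =
    [fset p in [seq p <- knight_paths n | 0 <= altitude p]]%fset.
  apply/fsetP => p; rewrite in_fset_set; last exact: finite_nonneg_paths.
  rewrite inE mem_filter mem_knight_paths.
  apply/idP/idP => [/set_mem[-> -> ->]|/and3P[p0 pk /eqP pn]].
    by rewrite eqxx.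
  exact/mem_set.
by rewrite card_fseq undup_id // filter_uniq // uniq_knight_paths.
Qed.

(** Reflecting one of the two copies gives the paths of altitude at most 0; the two families overlap
    exactly at altitude 0. *)
Lemma double_t n :
  ((t n).*2 = altitude_count xpredT n + altitude_count (pred1 0%R) n)%N.
Proof.
rewrite -addnn {1}t_altitude_count -altitude_count_opp t_altitude_count.
rewrite /altitude_count; elim: (knight_paths n) => //= p ps IH.
rewrite addnACA IH [RHS]addnACA -/(altitude p); congr (addn _ _).
by rewrite oppr_ge0; case: (ltrgtP (altitude p) 0).
Qed.

(** * Generating functions at a fixed altitude *)

(* The errors of the partial sums satisfy the homogeneous recurrence, hence
   decrease at least like [2 ^ - n]. *)
Lemma cvg_pseries_recurrence (R : realType) (z C : R) (x : nat -> int -> R)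
    (g : int -> R) (j : int) :
  0 <= z <= 8^-1 ->
  (forall j, x 1 j = x 0 (j - 2) + x 0 (j + 2)) ->
  (forall n j, x n.+2 j = x n.+1 (j - 2) + x n.+1 (j + 2)
                          + x n (j - 1) + x n (j + 1)) ->
  (forall j, `|g j| <= C) ->
  (forall j, g j = x 0 j + z * (g (j - 2) + g (j + 2))
                   + z ^+ 2 * (g (j - 1) + g (j + 1))) ->
  pseries (x^~ j) z @ \oo --> g j.
Proof.
move=> /andP[z0 z8] x1 xSS gC gE.
pose S n j := pseries (x^~ j) z n.
have S0 i : S 0 i = 0 by rewrite /S /pseries /series /= big_geq.
have SS n i : S n.+1 i = S n i + x n i * z ^+ n.
  by rewrite /S /pseries /series /= big_nat_recr.
have S1 i : S 1 i = x 0 i by rewrite SS S0 add0r mulr1.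
have SSS n i : S n.+2 i = x 0 i + z * (S n.+1 (i - 2) + S n.+1 (i + 2))
                   + z ^+ 2 * (S n (i - 1) + S n (i + 1)).
  elim: n i => [|n IHn] i; first by rewrite (SS 1) !S1 x1 !S0; ring.
  rewrite (SS n.+2) IHn xSS !(SS n.+1) !(SS n) !exprS; ring.
have C0 : 0 <= C := le_trans (normr_ge0 _) (gC 0).
have zz : z ^+ 2 <= 8^-1 * z by rewrite expr2 ler_wpM2r.
have bound n i : `|g i - S n i| <= C * 2^-1 ^+ n.
  elim/nat_ind2: n i => [||n IHn IHSn] i.
  - by rewrite S0 subr0 mulr1.
  - have -> : g i - S 1 i = z * (g (i - 2) + g (i + 2))
                   + z ^+ 2 * (g (i - 1) + g (i + 1)).
      by rewrite S1 [in LHS]gE; ring.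
    have := gC (i - 2); have := gC (i + 2); have := gC (i - 1).
    have := gC (i + 1); rewrite !ler_norml; nra.
  - have -> : g i - S n.+2 i =
        z * ((g (i - 2) - S n.+1 (i - 2)) + (g (i + 2) - S n.+1 (i + 2))) +
        z ^+ 2 * ((g (i - 1) - S n (i - 1)) + (g (i + 1) - S n (i + 1))).
      by rewrite SSS [in LHS]gE; ring.
    have := IHSn (i - 2); have := IHSn (i + 2); have := IHn (i - 1).
    have := IHn (i + 1); rewrite !exprS.
    have : 0 <= C * 2^-1 ^+ n by rewrite mulr_ge0 // exprn_ge0 // invr_ge0.
    have -> : C * (2^-1 * 2^-1 ^+ n) = 2^-1 * (C * 2^-1 ^+ n) by ring.
    have -> : C * (2^-1 * (2^-1 * 2^-1 ^+ n)) = 4^-1 * (C * 2^-1 ^+ n) by field.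
    move: (C * _) => D.
    rewrite !ler_norml; nra.
have cvg0 : (fun n => C * 2^-1 ^+ n) @ \oo --> (0 : R).
  by apply: cvg_geometric; rewrite ger0_norm; lra.
apply/cvgrPdist_le => e e0.
near=> n; apply: le_trans (bound n j) _.
near: n.
have /cvgrPdist_le /(_ e e0) := cvg0.
apply: filterS => n; rewrite sub0r normrN; apply: le_trans.
by rewrite ler_norm.
Unshelve. all: by end_near. Qed.

(** Away from 0 the powers form a geometric sequence on each side; the last term is the defect at
    the kink j = 0. *)
Lemma expr_absz_shift (R : fieldType) (v : R) (j : int) : v != 0 ->
  v ^+ absz (j + 1) + v ^+ absz (j - 1) =
  (v^-1 + v) * v ^+ absz j - (v^-1 - v) * (j == 0)%:R.
Proof.
move=> v0; case: (ltrgtP j 0) => [j0|j0|->].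
- have -> : absz (j - 1) = (absz j).+1 by lia.
  have -> : absz j = (absz (j + 1)).+1 by lia.
  by rewrite ?lt_eqF ?gt_eqF // !exprS /=; field.
- have -> : absz (j + 1) = (absz j).+1 by lia.
  have -> : absz j = (absz (j - 1)).+1 by lia.
  by rewrite ?lt_eqF ?gt_eqF // !exprS /=; field.
- by rewrite add0r sub0r /=; ring.
Qed.

(** Write w for [a^-1 + a]. Off the origin, neighbours at distance 1 add up to w f(j), hence those
    at distance 2 to (w^2 - 2) f(j), and the hypothesis says z (w^2 - 2) + z^2 w = 1. The kink
    leaves sources at j = -1, 0, 1 only. *)
Lemma kernel_root_recurrence (R : fieldType) (z a : R) (j : int) :
  a != 0 -> z * (a^-1 + a) ^+ 2 + z ^+ 2 * (a^-1 + a) = 1 + 2 * z ->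
  let f i := a^-1 ^+ absz i in
  f j = z * (f (j - 2) + f (j + 2)) + z ^+ 2 * (f (j - 1) + f (j + 1))
    + (a - a^-1) * (z * (a^-1 + a) * (j == 0)%:R
                    + z * ((j == 1)%:R + (j == -1)%:R)
                    + z ^+ 2 * (j == 0)%:R).
Proof.
move=> a0 wE f.
have E1 i : f (i + 1) = (a^-1 + a) * f i - (a - a^-1) * (i == 0)%:R - f (i - 1).
  apply: (addIr (f (i - 1))); rewrite subrK /f expr_absz_shift ?invr_neq0 //.
  by rewrite invrK [a + a^-1]addrC.
have EP : f (j + 2) = (a^-1 + a) * f (j + 1) - (a - a^-1) * (j == -1)%:R - f j.
  have -> : j + 2 = j + 1 + 1 by lia.
  by rewrite E1 addrK addr_eq0.
have EM : f (j - 2) = (a^-1 + a) * f (j - 1) - (a - a^-1) * (j == 1)%:R - f j.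
  have -> : j - 2 = j - 1 - 1 by lia.
  by have := E1 (j - 1); rewrite subrK subr_eq0 => ->; ring.
rewrite EP EM E1; move: (f j) (f (j - 1)) => F G.
move: (a^-1 + a) (a - a^-1) wE => w D wE.
apply/eqP; rewrite -subr_eq0; apply/eqP.
transitivity (F * (1 + 2 * z - (z * w ^+ 2 + z ^+ 2 * w))); first by ring.
by rewrite wE subrr mulr0.
Qed.

(* With [X1], [X2] the halves of the roots in [w] of the kernel, [u1] and [u2]
   are [X1 + sqrt (X1 ^ 2 - 1)] and [X2 - sqrt (X2 ^ 2 - 1)]. *)
Lemma kernel_roots (R : realType) (z : R) : 0 < z <= 8^-1 ->
  [/\ [/\ 0 <= rad0 z, 0 <= rad1 z & 0 <= rad2 z],
      1 < u1 z, u2 z < -1 ,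
      (u1 z)^-1 + u1 z + ((u2 z)^-1 + u2 z) = - z &
      z * ((u1 z)^-1 + u1 z) * ((u2 z)^-1 + u2 z) = - (1 + 2 * z)].
Proof.
move=> /andP[z0 z8].
have zn0 : z != 0 by rewrite gt_eqF.
have r0 : 0 <= rad0 z by rewrite /rad0; nra.
pose s := Num.sqrt (rad0 z).
have s0 : 0 <= s by exact: sqrtr_ge0.
have sE : s ^+ 2 = z ^+ 4 + 8 * z ^+ 2 + 4 * z by rewrite sqr_sqrtr.
(* This is [1 < X1] without denominators, and it implies [X2 < -1]. After squaring it amounts to 2 z
   + 2 z^2 < 1. *)
have sgt : 4 * z + z ^+ 2 < s.
  rewrite -(@ltr_pXn2r _ 2) // ?nnegrE //; last by nra.
  rewrite sE; nra.
pose X1 := (- z ^+ 2 + s) / (4 * z); pose X2 := (- z ^+ 2 - s) / (4 * z).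
have X1gt : 1 < X1 by rewrite /X1 ltr_pdivlMr; nra.
have X2lt : X2 < -1 by rewrite /X2 ltr_pdivrMr; nra.
have rad1E : rad1 z = 8 * (X1 ^+ 2 - 1).
  have -> : rad1 z = (z ^+ 3 - z * s - 4 * z + 2) / z by [].
  have -> : X1 ^+ 2 = (z ^+ 4 - 2 * z ^+ 2 * s + s ^+ 2) / (16 * z ^+ 2).
    by rewrite /X1; field.
  by rewrite sE; field.
have rad2E : rad2 z = 8 * (X2 ^+ 2 - 1).
  have -> : rad2 z = (z ^+ 3 + z * s - 4 * z + 2) / z by [].
  have -> : X2 ^+ 2 = (z ^+ 4 + 2 * z ^+ 2 * s + s ^+ 2) / (16 * z ^+ 2).
    by rewrite /X2; field.
  by rewrite sE; field.
have r1 : 0 <= rad1 z by rewrite rad1E; nra.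
have r2 : 0 <= rad2 z by rewrite rad2E; nra.
have c8 : (1 / (2 * Num.sqrt 2)) ^+ 2 = 8^-1 :> R.
  have s22 : Num.sqrt 2 ^+ 2 = 2 :> R by rewrite sqr_sqrtr.
  by rewrite expr_div_n exprMn s22; field.
have c0 : 0 <= 1 / (2 * Num.sqrt 2) :> R.
  by rewrite divr_ge0 // mulr_ge0 // sqrtr_ge0.
pose q1 := 1 / (2 * Num.sqrt 2) * Num.sqrt (rad1 z).
pose q2 := 1 / (2 * Num.sqrt 2) * Num.sqrt (rad2 z).
have q1E : q1 ^+ 2 = X1 ^+ 2 - 1.
  by rewrite exprMn c8 sqr_sqrtr // rad1E mulKf.
have q2E : q2 ^+ 2 = X2 ^+ 2 - 1.
  by rewrite exprMn c8 sqr_sqrtr // rad2E mulKf.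
have q10 : 0 <= q1 by rewrite mulr_ge0 ?sqrtr_ge0.
have q20 : 0 <= q2 by rewrite mulr_ge0 ?sqrtr_ge0.
have u1E : u1 z = X1 + q1 by [].
have u2E : u2 z = X2 - q2 by [].
have v1E : (u1 z)^-1 = X1 - q1.
  apply: (@mulIf _ (u1 z)); first by rewrite u1E; lra.
  rewrite mulVf; first by rewrite u1E -subr_sqr q1E; ring.
  by rewrite u1E; lra.
have v2E : (u2 z)^-1 = X2 + q2.
  apply: (@mulIf _ (u2 z)); first by rewrite u2E; lra.
  rewrite mulVf; first by rewrite u2E mulrC -subr_sqr q2E; ring.
  by rewrite u2E; lra.
split.
- by split.
- by rewrite u1E; lra.
- by rewrite u2E; lra.
- rewrite v1E v2E u1E u2E /X1 /X2; field.
  exact: zn0.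
- rewrite v1E v2E u1E u2E.
  have -> : z * (X1 - q1 + (X1 + q1)) * (X2 + q2 + (X2 - q2)) =
    (z ^+ 4 - s ^+ 2) / (4 * z) by rewrite /X1 /X2; field.
  rewrite sE; field.
  exact: zn0.
Qed.

Lemma altitude_count_pred1_1 (j : int) :
  altitude_count (pred1 j) 1 =
  (altitude_count (pred1 (j - 2)%R) 0 + altitude_count (pred1 (j + 2)%R) 0)%N.
Proof.
rewrite altitude_count1.
by congr (_ + _)%N; apply: eq_count => p /=; apply/eqP/eqP; lia.
Qed.

Lemma altitude_count_pred1_SS (j : int) n :
  altitude_count (pred1 j) n.+2 =
  (altitude_count (pred1 (j - 2)%R) n.+1 +
   altitude_count (pred1 (j + 2)%R) n.+1 +
   altitude_count (pred1 (j - 1)%R) n + altitude_count (pred1 (j + 1)%R) n)%N.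
Proof.
rewrite altitude_countSS.
by do ![congr (_ + _)%N]; apply: eq_count => p /=; apply/eqP/eqP; lia.
Qed.

(** The constant term accounts for all paths. Divided by [a - a^-1], resp. [b - b^-1], the two
    solutions from [kernel_root_recurrence] have the same sources at -1 and 1, which cancel in the
    difference; the last factor scales what remains at 0 to 1, the empty path. Inverse powers keep
    the solution bounded. *)
Lemma cvg_pseries_altitude (R : realType) (z a b : R) (j : int) :
  0 < z <= 8^-1 -> 1 < a -> b < -1 ->
  a^-1 + a + (b^-1 + b) = - z ->
  z * (a^-1 + a) * (b^-1 + b) = - (1 + 2 * z) ->
  pseries (fun n => (altitude_count xpredT n + altitude_count (pred1 j) n)%:R) z
    @ \oo -->
  (1 - 2 * z - 2 * z ^+ 2)^-1 +
  (a^-1 ^+ absz j / (a - a^-1) - b^-1 ^+ absz j / (b - b^-1))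
  / (z * ((a^-1 + a) - (b^-1 + b))).
Proof.
move=> /andP[z0 z8] a1 b1 wD wM.
have a0 : a != 0 by lra.
have b0 : b != 0 by lra.
have a'0 : 0 < a^-1 by rewrite invr_gt0; lra.
have b'0 : b^-1 < 0 by rewrite invr_lt0; lra.
have a'1 : a^-1 < 1 by rewrite invf_lt1; lra.
have b'1 : -1 < b^-1.
  by rewrite -[b]opprK invrN ltrN2 invf_lt1; lra.
have waP : z * (a^-1 + a) ^+ 2 + z ^+ 2 * (a^-1 + a) = 1 + 2 * z.
  move: (a^-1 + a) (b^-1 + b) wD wM => w w' wD.
  have -> : w' = - z - w by lra.
  by move=> wM; rewrite -[RHS]opprK -wM; ring.
have wbP : z * (b^-1 + b) ^+ 2 + z ^+ 2 * (b^-1 + b) = 1 + 2 * z.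
  move: (a^-1 + a) (b^-1 + b) wD wM => w w' wD.
  have -> : w = - z - w' by lra.
  by move=> wM; rewrite -[RHS]opprK -wM; ring.
have Da : a - a^-1 != 0 by lra.
have Db : b - b^-1 != 0 by lra.
have Dw : a^-1 + a - (b^-1 + b) != 0 by lra.
have DT : 1 - 2 * z - 2 * z ^+ 2 != 0 by nra.
pose T : R := (1 - 2 * z - 2 * z ^+ 2)^-1.
pose k := (z * (a^-1 + a - (b^-1 + b)))^-1.
pose fa i := a^-1 ^+ absz i; pose fb i := b^-1 ^+ absz i.
pose g i := T + (fa i / (a - a^-1) - fb i / (b - b^-1)) * k.
apply: (@cvg_pseries_recurrence _ z
  (`|T| + (`|(a - a^-1)^-1| + `|(b - b^-1)^-1|) * `|k|)
  (fun n i => (altitude_count xpredT n + altitude_count (pred1 i) n)%:R) g).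
- by rewrite z8 ltW.
- move=> i; rewrite altitude_count_pred1_1 altitude_count1 -natrD.
  by rewrite addnACA.
- move=> n i; rewrite altitude_count_pred1_SS altitude_countSS -!natrD.
  congr _%:R; rewrite 2!(addnACA _ (altitude_count _ n)).
  by rewrite (addnACA _ (altitude_count _ n.+1)).
- move=> i; rewrite (le_trans (ler_normD _ _)) // lerD2l normrM ler_wpM2r //.
  rewrite (le_trans (ler_normB _ _)) // !normrM lerD // ler_piMl //.
    by rewrite normrX exprn_ile1 // ger0_norm; lra.
  by rewrite normrX exprn_ile1 // ler0_norm; lra.
- move=> i.
  have Ea : fa i = _ := kernel_root_recurrence i a0 waP.
  have Eb : fb i = _ := kernel_root_recurrence i b0 wbP.
  rewrite altitude_count0 [altitude_count _ 0]altitude_count0 /= natrD.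
  rewrite /g Ea Eb -!/(fa _) -!/(fb _) [0 == i]eq_sym /T /k.
  do 4![move: (fa _)]; do 4![move: (fb _)].
  have zn0 : z != 0 by rewrite gt_eqF.
  move: Da Db Dw DT zn0; move: (a - _) (b - _) (_ + a) (_ + b); clear.
  by move=> *; field; do ![apply/andP; split].
Qed.

(** * Algebraic reduction to the stated closed form *)

(* In terms of [s] and [p] the two relations on [a] and [b] say that
   [z p + s (1 + p) = 0] and [z (p^2 + s^2 + 1) + p = 0]. *)
Lemma nonneg_gf_closed_form (R : fieldType) (z a b : R) :
  let s := a + b in let p := a * b in
  let h := 1 + p - 2 * z ^+ 2 * s - 2 * z
     + 2 * z * (1 - a ^+ 2 - b ^+ 2) * a^-1 * b^-1 in
  z != 0 -> a != 0 -> b != 0 -> p != 1 -> a ^+ 2 != 1 -> b ^+ 2 != 1 ->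
  a != b ->
  a^-1 + a + (b^-1 + b) = - z ->
  z * (a^-1 + a) * (b^-1 + b) = - (1 + 2 * z) ->
  [/\ 1 + p != 0, h != 0 &
    (1 - 2 * z - 2 * z ^+ 2)^-1 +
  (a^-1 ^+ 0 / (a - a^-1) - b^-1 ^+ 0 / (b - b^-1))
  / (z * ((a^-1 + a) - (b^-1 + b)))
  = 2 * (((1 + p) / h * a * b - s / (1 + p) * ((1 + p) / h))
     / ((1 - a) * (1 - b)))].
Proof.
move=> s p h z0 a0 b0 p1 a1 b1 ab wD wM.
have p0 : p != 0 by rewrite mulf_neq0.
have R1 : z * p + s * (1 + p) = 0.
  by rewrite -[z]opprK -wD /s /p; field; rewrite a0 b0.
have R2 : z * (p ^+ 2 + s ^+ 2 + 1) + p = 0.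
  have -> : z * (p ^+ 2 + s ^+ 2 + 1) + p =
      p * (z * (a^-1 + a) * (b^-1 + b) + (1 + 2 * z)).
    by rewrite /s /p; field; rewrite a0 b0.
  by rewrite wM addNr mulr0.
have sp0 : 1 + p != 0.
  apply/eqP => sp; move: R1; rewrite sp mulr0 addr0 => /eqP.
  by rewrite mulf_eq0 (negbTE z0) (negbTE p0).
(* Modulo [R1] and [R2], [h] splits into factors that the hypotheses make nonzero. *)
have hE : h = - z * (p - 1) * ((a ^+ 2 - 1) * (b ^+ 2 - 1)) / p.
  have -> : (a ^+ 2 - 1) * (b ^+ 2 - 1) = (1 + p) ^+ 2 - s ^+ 2.
    by rewrite /s /p; ring.
  apply: (mulIf p0); rewrite divfK //; apply/eqP; rewrite -subr_eq0.
  have -> : h * p = p + p ^+ 2 - 2 * z ^+ 2 * s * p - 2 * z * p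
      + 2 * z * (1 - s ^+ 2 + 2 * p) by rewrite /h /s /p; field; rewrite a0 b0.
  apply/eqP; transitivity (- 2 * z * s * (z * p + s * (1 + p)) +
      (1 + p) * (z * (p ^+ 2 + s ^+ 2 + 1) + p)); first ring.
  by rewrite R1 R2 !mulr0 addr0.
(* K(1), factored through the four zeros a, 1/a, b, 1/b of the kernel. *)
have TE : 1 - 2 * z - 2 * z ^+ 2 = - z * ((1 - a) * (1 - b)) ^+ 2 / p.
  have -> : (1 - a) * (1 - b) = 1 - s + p by rewrite /s /p; ring.
  apply: (mulIf p0); rewrite divfK //; apply/eqP; rewrite -subr_eq0.
  apply/eqP; transitivity (- 2 * z * (z * p + s * (1 + p)) +
      (z * (p ^+ 2 + s ^+ 2 + 1) + p)); first ring.
  by rewrite R1 R2 mulr0 addr0.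
rewrite -subr_eq0 in a1; rewrite -subr_eq0 in b1.
rewrite -subr_eq0 in ab; rewrite -subr_eq0 in p1.
have /andP[am ap] : (1 - a != 0) && (1 + a != 0).
  rewrite -negb_or -mulf_eq0 -oppr_eq0.
  by have -> : - ((1 - a) * (1 + a)) = a ^+ 2 - 1 by ring.
have /andP[bm bp] : (1 - b != 0) && (1 + b != 0).
  rewrite -negb_or -mulf_eq0 -oppr_eq0.
  by have -> : - ((1 - b) * (1 + b)) = b ^+ 2 - 1 by ring.
split=> //.
  by rewrite hE !mulf_neq0 ?invr_neq0 ?oppr_eq0.
rewrite TE hE.
clear hE TE R1 R2 wD wM h.
rewrite /s /p; rewrite /p in p0 p1 sp0.
field.
rewrite a0 b0 z0 am bm a1 b1 p1 sp0 oppr_eq0 z0 /=.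
(* The numerator of a + 1/a - (b + 1/b). *)
have -> : (1 + a * a) * b + - (1 + b * b) * a = (a - b) * (a * b - 1) by ring.
by rewrite mulf_neq0.
Qed.

(** * Asymptotics *)

Lemma sum_altitude_count_le (k n : nat) (f : 'I_k -> int) : injective f ->
  (\sum_(i < k) altitude_count (pred1 (f i)) n <= altitude_count xpredT n)%N.
Proof.
move=> f_inj; rewrite /altitude_count; elim: (knight_paths n) => [|p ps IH] /=.
  by rewrite big1.
rewrite big_split leq_add //.
have [i0 /= fi0|nofi] := pickP (fun i => altitude p == f i).
  rewrite (bigD1 i0) //= fi0 big1 // => i ii0.
  by rewrite (eqP fi0) (inj_eq f_inj) eq_sym (negbTE ii0).
by rewrite big1 // => i _; rewrite nofi.
Qed.

Section Asymptotics.
Context {R : realType}.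
(** The growth rate of all paths: the positive root of x^2 = 2 x + 2, with two steps of each
    length. *)
Let lam : R := 1 + Num.sqrt 3.

Let lamE : lam ^+ 2 = 2 * lam + 2.
Proof.
have s3 : Num.sqrt 3 ^+ 2 = 3 :> R by rewrite sqr_sqrtr.
by rewrite /lam sqrrD s3; ring.
Qed.

Let lam_gt2 : 2 < lam.
Proof. have : 0 <= lam by rewrite addr_ge0 ?sqrtr_ge0. move: lamE; nra. Qed.

(** Proportions relative to [lam ^+ n], which bounds the number of all paths, so they add up to at
    most 1. *)
Let b (n : nat) (j : int) : R := (altitude_count (pred1 j) n)%:R / lam ^+ n.

Let bE n j : lam ^+ 2 * b n.+2 j =
  lam * (b n.+1 (j - 2) + b n.+1 (j + 2)) + (b n (j - 1) + b n (j + 1)).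
Proof.
have l0 : lam != 0 by move: lam_gt2; lra.
rewrite /b altitude_count_pred1_SS !natrD !exprS; field.
by rewrite expf_neq0 // l0.
Qed.

Let b_ge0 n j : 0 <= b n j.
Proof. by rewrite divr_ge0 // exprn_ge0 //; move: lam_gt2; lra. Qed.

Let total_le n : (altitude_count xpredT n)%:R <= lam ^+ n.
Proof.
elim/nat_ind2: n => [||n IHn IHSn];
  rewrite ?altitude_count1 ?altitude_count0 //.
  by move: lam_gt2; rewrite expr1 ltW.
rewrite altitude_countSS !natrD !exprS mulrA -expr2 lamE.
rewrite exprS in IHSn; nra.
Qed.

Let sum_b_le k n (f : 'I_k -> int) : injective f -> \sum_i b n (f i) <= 1.
Proof.
move=> f_inj; rewrite -mulr_suml ler_pdivrMr; last first.
  by rewrite exprn_gt0 //; move: lam_gt2; lra.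
rewrite mul1r -natr_sum (le_trans _ (total_le n)) // ler_nat.
exact: sum_altitude_count_le.
Qed.

Let b_le1 n j : b n j <= 1.
Proof.
have := @sum_b_le 1 n (fun=> j); rewrite big_ord1; apply=> x y _.
by rewrite !ord1.
Qed.

(* Since [b n.+2 j] is an average, if it nearly attains the asymptotic bound
   [x] then so do its ancestors. *)
Let near_max_pred (N : nat) (x e d : R) : 0 <= e <= d ->
  (forall n j, (N <= n)%N -> b n j <= x + e) ->
  forall n j, (N <= n)%N -> x - d <= b n.+2 j ->
  x - 9 * d <= b n.+1 (j - 2) /\ x - 9 * d <= b n.+1 (j + 2).
Proof.
move=> /andP[e0 ed] ub n j Nn xd.
have := bE n j; rewrite lamE.
have := ub n.+1 (j - 2) (leqW Nn); have := ub n.+1 (j + 2) (leqW Nn).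
have := ub n (j - 1) Nn; have := ub n (j + 1) Nn.
move: lam_gt2 => l2.
move: xd; move: (b n.+2 j) (b n.+1 (j - 2)) (b n.+1 (j + 2)).
move: (b n (j - 1)) (b n (j + 1)) => B3 B4.
move=> B B1 B2 h h4 h3 h2 h1 hE.
have h' : (2 * lam + 2) * (x - d) <= (2 * lam + 2) * B.
  by rewrite ler_pM2l //; lra.
have l0 : 0 < lam by lra.
have h1' : lam * B1 <= lam * (x + e) by rewrite ler_pM2l.
have h2' : lam * B2 <= lam * (x + e) by rewrite ler_pM2l.
have led : lam * e <= lam * d by rewrite ler_pM2l.
have ld : 2 * d <= lam * d by rewrite ler_wpM2r //; lra.
(* With the three other terms at most [x + e], the shortfall is at most (3 + 4 / lam) d, which 9 d
   absorbs since 2 < lam. *)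
by split; rewrite -(ler_pM2l l0); lra.
Qed.

(** Each step back along (1, 2) or (1, -2) multiplies the loss by at most 9; [i] counts the moves up
    among the [k] moves. *)
Let near_max_iter (N : nat) (x e : R) (k : nat) : 0 <= e ->
  (forall n j, (N <= n)%N -> b n j <= x + e) ->
  forall n j, (N + k < n)%N -> x - e <= b n j ->
  forall i, (i <= k)%N ->
    x - 9 ^+ k * e <= b (n - k)%N (j - (2 * k)%N%:Z + (4 * i)%N%:Z).
Proof.
move=> e0 ub n j; elim: k => [|k IH] Nn bn i ik.
  move: ik; rewrite leqn0 => /eqP ->.
  by rewrite expr0 mul1r subn0 !muln0 subr0 addr0.
have Nk : (N + k < n)%N by lia.
have [m mE] : exists m, (n - k)%N = m.+2 by exists (n - k - 2)%N; lia.
have Nm : (N <= m)%N by lia.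
have ed : 0 <= e <= 9 ^+ k * e.
  by rewrite e0 ler_peMl // exprn_ege1 // ler1n.
have -> : (n - k.+1 = m.+1)%N by lia.
have step i' := @near_max_pred N x e _ ed ub m i' Nm.
rewrite exprS -mulrA.
(* Every altitude but the highest lies 2 below the one of the same index in the previous row; the
   highest lies 2 above the previous highest. *)
case: (leqP i k) => [ik'|ki].
  have := IH Nk bn i ik'; rewrite mE => /step[+ _].
  by congr (_ <= b _ _); lia.
have := IH Nk bn k (leqnn k); rewrite mE => /step[_].
by congr (_ <= b _ _); lia.
Qed.

Lemma altitude_count_pred1_little_o (j : int) :
  (fun n => (altitude_count (pred1 j) n)%:R / (1 + Num.sqrt 3) ^+ n) @ \oo
    --> (0 : R).
Proof.
(* The eventual uniform upper bounds: [inf S] is the limsup beta. *)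
pose S : set R := [set x | exists N, forall n j, (N <= n)%N -> b n j <= x].
have S1 : S 1 by exists 0 => n i _; exact: b_le1.
have Slb : lbound S 0.
  by move=> x [N Nx]; apply: le_trans (Nx N 0 (leqnn _)).
have Sinf : has_inf S by split; [exists 1 | exists 0].
have inf0 : inf S = 0.
  apply/eqP; rewrite eq_le; apply/andP; split; last first.
    by apply: lb_le_inf => //; exists 1.
  rewrite leNgt; apply/negP => beta0.
  set x := inf S in beta0.
  have [k kx] : exists k : nat, 2 < x * k.+1%:R.
    exists (Num.bound (2 / x)); rewrite mulrC -ltr_pdivrMr //.
    have x2 : 0 <= 2 / x by rewrite divr_ge0 // ltW.
    by apply: lt_trans (archi_boundP x2) _; rewrite ltr_nat.
  have p9 : 0 < 9 ^+ k :> R by rewrite exprn_gt0.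
  (* After [k] steps the loss [9 ^+ k * e] is x / 2, so k + 1 proportions are at least x / 2, and by
     [kx] their sum exceeds 1. *)
  pose e := x / 2 / 9 ^+ k.
  have e0 : 0 < e by rewrite !divr_gt0.
  have [y [N Ny] yx] := inf_adherent e0 Sinf.
  have ub n i : (N <= n)%N -> b n i <= x + e.
    by move=> Nn; apply: le_trans (Ny n i Nn) (ltW yx).
  have [n [i [Nn bn]]] : exists n i, (N + k < n)%N /\ x - e < b n i.
    apply: contrapT => nex.
    suff : x <= x - e by lra.
    apply: ge_inf; first by exists 0.
    exists (N + k).+1 => n i Nn; rewrite leNgt; apply/negP => bn.
    by apply: nex; exists n, i.
  have lo := near_max_iter (ltW e0) ub Nn (ltW bn).
  pose f (l : 'I_k.+1) : int := i - (2 * k)%N%:Z + (4 * l)%N%:Z.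
  have f_inj : injective f.
    by move=> l l' /addrI [] ll'; apply: val_inj => /=; lia.
  have := @sum_b_le k.+1 (n - k)%N f f_inj; apply/negP; rewrite -ltNge.
  have -> : (1 : R) = 2^-1 * 2 by rewrite mulVf.
  apply: (@lt_le_trans _ _ (\sum_(l < k.+1) (x / 2))).
    by rewrite sumr_const card_ord -mulr_natr; lra.
  apply: ler_sum => l _; apply: le_trans (lo l (ltn_ord l)).
  have -> : 9 ^+ k * e = x / 2 by rewrite mulrC divfK // gt_eqF.
  by lra.
apply/cvgrPdist_lt => e e0.
have [y [N Ny]] := inf_adherent e0 Sinf.
rewrite inf0 add0r => ye.
exists N => // n /= Nn.
rewrite sub0r normrN ger0_norm ?b_ge0 //; exact: le_lt_trans (Ny n j Nn) ye.
Qed.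

(** A Binet formula: 1 + sqrt 3 and 1 - sqrt 3 are the roots of x^2 = 2 x + 2. *)
Let total_closed n : (altitude_count xpredT n)%:R =
  (lam ^+ n.+1 - (1 - Num.sqrt 3) ^+ n.+1) / (2 * Num.sqrt 3) :> R.
Proof.
have s3 : Num.sqrt 3 ^+ 2 = 3 :> R by rewrite sqr_sqrtr.
have s0 : Num.sqrt 3 != 0 :> R by rewrite gt_eqF // sqrtr_gt0.
have muE : (1 - Num.sqrt 3) ^+ 2 = 2 * (1 - Num.sqrt 3) + 2 :> R.
  by rewrite sqrrB s3; ring.
elim/nat_ind2: n => [||n IHn IHSn].
- by rewrite altitude_count0 !expr1 /lam /=; field; exact: s0.
- rewrite altitude_count1 !altitude_count0 lamE muE /lam /=; field; exact: s0.
- rewrite altitude_countSS !natrD IHSn IHn !(exprS _ n.+2) !(exprS _ n.+1).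
  rewrite !mulrA -!expr2 lamE muE !(exprS _ n); field. exact: s0.
Qed.

Lemma t_asymptotics :
  (fun n => (t n)%:R / (Num.sqrt 3 / 12 * (1 + Num.sqrt 3) ^+ n.+1) : R)
    @ \oo --> (1 : R).
Proof.
have s3 : Num.sqrt 3 ^+ 2 = 3 :> R by rewrite sqr_sqrtr.
have s0 : 0 < Num.sqrt 3 :> R by rewrite sqrtr_gt0.
have l0 : lam != 0 by move: lam_gt2; lra.
have tE n : (t n)%:R / (Num.sqrt 3 / 12 * lam ^+ n.+1) =
   1 - (1 - Num.sqrt 3) / lam * ((1 - Num.sqrt 3) / lam) ^+ n
    + 2 * Num.sqrt 3 / lam * ((altitude_count (pred1 0) n)%:R / lam ^+ n) :> R.
  have -> : (t n)%:R = ((altitude_count xpredT n)%:R +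
      (altitude_count (pred1 0) n)%:R) / 2 :> R.
    by rewrite -natrD -double_t -muln2 natrM mulfK.
  (* Half of the factor 1 / (2 sqrt 3) in [total_closed]; the half comes from [double_t]. *)
  have c : Num.sqrt 3 / 12 = (4 * Num.sqrt 3)^-1 :> R.
    apply: (@mulIf _ (4 * Num.sqrt 3)); first lra.
    rewrite mulVf; last lra.
    have -> : Num.sqrt 3 / 12 * (4 * Num.sqrt 3) = Num.sqrt 3 ^+ 2 / 3 :> R.
      by field.
    by rewrite s3 divff.
  rewrite total_closed c expr_div_n !exprS; field.
  by rewrite expf_neq0 // l0 gt_eqF.
rewrite (_ : (fun n => _) = (fun n => 1 - (1 - Num.sqrt 3) / lam *
  ((1 - Num.sqrt 3) / lam) ^+ n + 2 * Num.sqrt 3 / lam *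
  ((altitude_count (pred1 0) n)%:R / lam ^+ n))); last exact/funext.
rewrite -[X in _ --> X]addr0 -[X in _ --> X + _]subr0.
apply: cvgD; last first.
  rewrite -(mulr0 (2 * Num.sqrt 3 / lam)).
  by apply: cvgMr; exact: altitude_count_pred1_little_o.
apply: cvgB; first exact: cvg_cst.
apply: cvg_geometric.
rewrite normrM normfV ltr_pdivrMr ?normr_gt0 // mul1r.
rewrite (ger0_norm (_ : 0 <= lam)); last by move: lam_gt2; lra.
by rewrite ltr_norml /lam; nra.
Qed.

End Asymptotics.

(* The identity of (convergent) Laurent series in z^(1/2), with principal values
   of the square roots for small z > 0, is an identity of germs at 0+. *)
Theorem corollary2p2 (R : realType) :
  (\forall z \near (0 : R)^'+,
     well_defined z /\
     pseries (fun n => (t n)%:R) z @ \oo -->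
       (h0 z * u1 z * u2 z - h1 z) / ((1 - u1 z) * (1 - u2 z)))
  /\
  (fun n => (t n)%:R / (Num.sqrt 3 / 12 * (1 + Num.sqrt 3) ^+ n.+1) : R)
    @ \oo --> (1 : R).
Proof.
split; last exact: t_asymptotics.
near=> z.
have z0 : 0 < z by near: z; exact: nbhs_right_gt.
have z8 : z <= 8^-1 by near: z; exact: nbhs_right_le.
have z08 : 0 < z <= 8^-1 by rewrite z0.
have [rad a1 b1 wD wM] := kernel_roots z08.
have a0 : u1 z != 0 by lra.
have b0 : u2 z != 0 by lra.
have p1 : u1 z * u2 z != 1 by rewrite lt_eqF //; nra.
have a2 : u1 z ^+ 2 != 1 by rewrite gt_eqF //; nra.
have b2 : u2 z ^+ 2 != 1 by rewrite gt_eqF //; nra.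
have ab : u1 z != u2 z by lra.
have [sp0 hn0 gfE] :=
  nonneg_gf_closed_form (lt0r_neq0 z0) a0 b0 p1 a2 b2 ab wD wM.
split.
  by split=> //; rewrite mulf_neq0 //; lra.
have := @cvg_pseries_altitude R z _ _ 0 z08 a1 b1 wD wM.
rewrite [X in _ --> X]gfE => cv.
(* By [double_t], altitude 0 in [cvg_pseries_altitude] gives twice the series. *)
have -> : pseries (fun n => (t n)%:R) z = (fun n => 2^-1 *
    pseries (fun n => (altitude_count xpredT n
      + altitude_count (pred1 0%R) n)%:R) z n).
  apply/funext => n; rewrite /pseries /series /= mulr_sumr.
  apply: eq_bigr => k _.
  by rewrite -double_t -muln2 natrM mulrA [2^-1 * _]mulrC mulfK.
rewrite -[X in _ --> X](mulKf (_ : 2 != 0 :> R)) //.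
exact: cvgMr.
Unshelve. all: by end_near. Qed.
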